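(* Let $n$ be a positive integer. The hypersurface of $\mathbb{R}^{n+1}$ $$M^n:\ (x^{n+1})^2\left[(x^1)^2+\cdots+(x^n)^2\right]^n=1$$ is a Tzitzeica hypersurface, with $$Tzitzeica(M^n)=\frac{(-n)^n}{(n+1)^{n+1}}.$$
   Context: For a hypersurface $M^n\subset\mathbb{R}^{n+1}$, the Tzitzeica function is $Tzitzeica(M^n)=\frac{K}{d^{n+2}}$, where $K$ is the Gaussian curvature of $M^n$ at a point $p$ and $d$ is the distance from the origin of $\mathbb{R}^{n+1}$ to the tangent hyperplane $T_pM$. The hypersurface $M^n$ is called a Tzitzeica hypersurface if $Tzitzeica(M^n)$ is a real constant, i.e. independent of $p\in M^n$. Conventions: for $M^n$ given implicitly by $F(x^1,\dots,x^{n+1})=0$, write $F_i=\partial F/\partial x^i$ and $F_{ij}=\partial^2F/\partial x^i\partial x^j$ for $1\le i,j\le n+1$. The unit normal is chosen as $N=-\frac{\nabla F}{\|\nabla F\|}$, and the Gaussian curvature is $$K=-\frac{\begin{vmatrix}F_{ij}&F_i\\ F_j&0\end{vmatrix}}{\|\nabla F\|^{n+2}},$$ where the numerator is the $(n+2)\times(n+2)$ bordered Hessian determinant. The distance from the origin to the tangent hyperplane at $p=(x^i)$ is $d=\frac{|F_ix^i|}{\|\nabla F\|}$, with summation over $i=1,\dots,n+1$. The hypersurface is written as $x^{n+1}=f\left(\sqrt{(x^1)^2+\cdots+(x^n)^2}\right)$ with $f(t)=t^{-n}$ for $t>0$, and the defining function used is $F(x^1,\dots,x^{n+1})=f\left(\sqrt{(x^1)^2+\cdots+(x^n)^2}\right)-x^{n+1}$.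 Choosing the opposite normal $-N$ is regarded as replacing $Tzitzeica(M^n)$ by $-Tzitzeica(M^n)$.
   Formalization: With the unit normal N = -∇F/‖∇F‖ and the given K, the value is -(-n)^n/(n+1)^(n+1) (n=1: +1/4, not -1/4); the stated value is proved for the opposite normal -N, under the convention that -N replaces Tzitzeica by -Tzitzeica. *)

(* Defs.v *)
From HB Require Import structures.
From mathcomp Require Import all_boot all_order all_algebra.
From mathcomp Require Import all_classical all_reals all_analysis.

Set Implicit Arguments.
Unset Strict Implicit.
Unset Printing Implicit Defensive.

Import Order.TTheory GRing.Theory Num.Theory.
Import numFieldNormedType.Exports.

Local Open Scope classical_set_scope.
Local Open Scope ring_scope.

(* Points of R^(n+1) are row vectors 'rV[R]_n.+1; the coordinate x^(n+1) is the
   one of index ord_max.  The library norm on row vectors is the sup norm (it is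
   used below only for its topology), hence the explicit Euclidean norm. *)

Definition dotv (R : realType) (m : nat) (u v : 'rV[R]_m) : R :=
  \sum_(i < m) u 0 i * v 0 i.

Definition enorm (R : realType) (m : nat) (u : 'rV[R]_m) : R :=
  Num.sqrt (dotv u u).

Definition partial (R : realType) (n : nat) (i : 'I_n.+1)
    (F : 'rV[R]_n.+1 -> R) : 'rV[R]_n.+1 -> R :=
  fun x => 'D_(delta_mx 0 i) F x.

Definition grad (R : realType) (n : nat) (F : 'rV[R]_n.+1 -> R)
    (p : 'rV[R]_n.+1) : 'rV[R]_n.+1 :=
  \row_i partial i F p.

Definition hessian (R : realType) (n : nat) (F : 'rV[R]_n.+1 -> R)
    (p : 'rV[R]_n.+1) : 'M[R]_n.+1 :=
  \matrix_(i, j) partial i (partial j F) p.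

Definition bordered_hessian (R : realType) (n : nat) (F : 'rV[R]_n.+1 -> R)
    (p : 'rV[R]_n.+1) : 'M[R]_(n.+1 + 1) :=
  block_mx (hessian F p) (grad F p)^T (grad F p) 0.

Definition C2_near (R : realType) (n : nat) (F : 'rV[R]_n.+1 -> R)
    (p : 'rV[R]_n.+1) : Prop :=
  \forall q \near p,
    [/\ differentiable F q,
        forall i, differentiable (partial i F) q
      & forall i j, {for q, continuous (partial i (partial j F))}].

Definition defines_near (R : realType) (n : nat) (M : set 'rV[R]_n.+1)
    (F : 'rV[R]_n.+1 -> R) (p : 'rV[R]_n.+1) : Prop :=
  [/\ C2_near F p, grad F p != 0 & \forall q \near p, M q <-> F q = 0].

(* A hypersurface M together with, for each p in M, the function [Phi p] used
   to write M implicitly near p (one function per sheet of M). *)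
Definition hypersurface (R : realType) (n : nat) (M : set 'rV[R]_n.+1)
    (Phi : 'rV[R]_n.+1 -> 'rV[R]_n.+1 -> R) : Prop :=
  forall p, M p -> defines_near M (Phi p) p.

Definition unit_normal (R : realType) (n : nat) (F : 'rV[R]_n.+1 -> R)
    (p : 'rV[R]_n.+1) : 'rV[R]_n.+1 :=
  - ((enorm (grad F p))^-1 *: grad F p).

Definition gauss_curvature (R : realType) (n : nat) (F : 'rV[R]_n.+1 -> R)
    (p : 'rV[R]_n.+1) : R :=
  - (\det (bordered_hessian F p) / enorm (grad F p) ^+ n.+2).

Definition tangent_hyperplane (R : realType) (n : nat)
    (F : 'rV[R]_n.+1 -> R) (p : 'rV[R]_n.+1) : set 'rV[R]_n.+1 :=
  [set q | dotv (grad F p) (q - p) = 0].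

(* Distance from the origin to the tangent hyperplane, as an infimum; where the
   gradient does not vanish it equals |F_i x^i| / ||grad F||. *)
Definition tangent_dist (R : realType) (n : nat) (F : 'rV[R]_n.+1 -> R)
    (p : 'rV[R]_n.+1) : R :=
  inf [set enorm q | q in tangent_hyperplane F p].

(* The Tzitzeica function at p of the hypersurface F = 0 for the choice nu of a
   unit normal at p, nu being either [unit_normal F p] or its opposite.  The
   factor [dotv nu (unit_normal F p)] is 1 in the first case and -1 in the
   second: passing to the opposite normal changes the sign, by convention, in
   every dimension (including even n, where replacing F by -F does not change
   [gauss_curvature]). *)
Definition tzitzeica (R : realType) (n : nat) (F : 'rV[R]_n.+1 -> R)
    (nu p : 'rV[R]_n.+1) : R :=
  dotv nu (unit_normal F p) * (gauss_curvature F p / tangent_dist F p ^+ n.+2).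

Definition tzitzeica_hypersurface (R : realType) (n : nat)
    (M : set 'rV[R]_n.+1) (Phi : 'rV[R]_n.+1 -> 'rV[R]_n.+1 -> R)
    (nu : 'rV[R]_n.+1 -> 'rV[R]_n.+1) : Prop :=
  hypersurface M Phi /\
  exists c : R, forall p, M p -> tzitzeica (Phi p) (nu p) p = c.

(* (x^1)^2 + ... + (x^n)^2, without the last coordinate. *)
Definition sqradius (R : realType) (n : nat) (x : 'rV[R]_n.+1) : R :=
  \sum_(i < n) x 0 (widen_ord (leqnSn n) i) ^+ 2.

Definition Mn (R : realType) (n : nat) : set 'rV[R]_n.+1 :=
  [set x : 'rV[R]_n.+1 | x 0 ord_max ^+ 2 * sqradius x ^+ n = 1].

Definition profile (R : realType) (n : nat) (t : R) : R := t ^- n.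

Definition graph_eq (R : realType) (n : nat) (x : 'rV[R]_n.+1) : R :=
  profile n (Num.sqrt (sqradius x)) - x 0 ord_max.

Definition reflect_last (R : realType) (n : nat) (x : 'rV[R]_n.+1) :
    'rV[R]_n.+1 :=
  \row_i (if i == ord_max then - x 0 i else x 0 i).

(* [graph_eq] vanishes only on the part x^(n+1) > 0 of M^n; the part
   x^(n+1) < 0 is its mirror image and is written by the mirrored function. *)
Definition Mn_eq (R : realType) (n : nat) (p : 'rV[R]_n.+1) :
    'rV[R]_n.+1 -> R :=
  if 0 < p 0 ord_max then @graph_eq R n
  else fun x => graph_eq (reflect_last x).

(* The normal -N = grad F / ||grad F||.  For N itself the Tzitzeica function of
   M^n is the opposite constant - (-n)^n / (n+1)^(n+1). *)
Definition Mn_normal (R : realType) (n : nat) (p : 'rV[R]_n.+1) :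
    'rV[R]_n.+1 :=
  - unit_normal (Mn_eq p) p.

(* Main.v *)
(** Both sheets of M^n are graphs e x^(n+1) = r^(-n), with e = 1 or -1 and
    r^2 = (x^1)^2 + ... + (x^n)^2, so it suffices to treat F = r^(-n) - e x^(n+1).
    With x' = (x^1, ..., x^n, 0), a = - n r^(-n-2) and c = n (n+2) r^(-n-4), the
    gradient is a x' - e e_(n+1) and the Hessian is a (I - E) + c x'^T x', where
    E is the matrix unit of index (n+1, n+1).  In the bordered determinant,
    multiples of the gradient may be added to rows and columns, which turns x'
    into a multiple of e_(n+1) and the Hessian into a diagonal matrix; the
    determinant is then - a^n (c r^2 / a + 1) = (n+1) (-n)^n r^(-n(n+2)).  Since
    grad F . x = - (n+1) r^(-n) on the hypersurface, the powers of r and the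
    norms of the gradient cancel in K / d^(n+2). *)

Require Import Defs.
From HB Require Import structures.
From mathcomp Require Import all_boot all_order all_algebra.
From mathcomp Require Import all_classical all_reals all_analysis.
From mathcomp Require Import ring.

Import Order.TTheory GRing.Theory Num.Theory.
Import numFieldNormedType.Exports.

Local Open Scope classical_set_scope.
Local Open Scope ring_scope.

(** * Bordered determinants *)

(** Adding multiples of the border to the other rows and columns amounts to multiplying by
    unitriangular block matrices, of determinant 1. *)
Lemma det_bordered_add (R : comNzRingType) (m : nat) (D : 'M[R]_m)
    (u w w' : 'rV[R]_m) :
  \det (block_mx (D + (u^T *m w + w'^T *m u)) u^T u 0 : 'M[R]_(m + 1)) =
  \det (block_mx D u^T u 0 : 'M[R]_(m + 1)).
Proof.
have -> : block_mx (D + (u^T *m w + w'^T *m u)) u^T u 0 =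
  block_mx 1%:M w'^T 0 1%:M *m block_mx D u^T u 0 *m block_mx 1%:M 0 w 1%:M.
  rewrite !mulmx_block !(mul0mx, mul1mx, mulmx0, mulmx1, addr0, add0r).
  by congr block_mx; rewrite -addrA [_ + u^T *m w]addrC.
by rewrite !det_mulmx det_ublock det_lblock !det1 !(mul1r, mulr1).
Qed.

(** With [D = diag_mx d], subtracting the columns combined by [y], the vector D^-1 u^T, clears the
    border column and leaves the Schur complement - u D^-1 u^T in the corner. *)
Lemma det_bordered_diag (R : fieldType) (m : nat) (d u : 'rV[R]_m) :
  (forall i, d 0 i != 0) ->
  \det (block_mx (diag_mx d) u^T u 0 : 'M[R]_(m + 1)) =
  - ((\prod_i d 0 i) * \sum_i u 0 i ^+ 2 / d 0 i).
Proof.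
move=> d0; pose y : 'cV[R]_m := \col_i (u 0 i / d 0 i).
have E : block_mx (diag_mx d) u^T u 0 *m block_mx 1%:M (- y) 0 1%:M =
    block_mx (diag_mx d) 0 u (- (u *m y)) :> 'M[R]_(m + 1).
  rewrite mulmx_block !(mulmx0, mulmx1, addr0, add0r) !mulmxN.
  congr block_mx; apply/matrixP => i j.
  by rewrite mul_diag_mx !mxE ord1 mulrC divfK// addNr.
have := congr1 determinant E.
rewrite det_mulmx det_ublock !det1 !mulr1 => ->.
rewrite det_lblock det_diag det_mx11 !mxE mulrN; congr (- (_ * _)).
by apply: eq_bigr => i _; rewrite !mxE mulrA expr2.
Qed.

(** * Euclidean geometry and the distance to the tangent hyperplane *)

Section euclidean.
Context {R : realType} {m : nat}.
Implicit Types (u v w : 'rV[R]_m) (k : R).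

Lemma dotvC u v : dotv u v = dotv v u.
Proof. by apply: eq_bigr => i _; rewrite mulrC. Qed.

Lemma dotvDr u v w : dotv u (v + w) = dotv u v + dotv u w.
Proof. by rewrite -big_split; apply: eq_bigr => i _; rewrite mxE mulrDr. Qed.

Lemma dotvZr k u v : dotv u (k *: v) = k * dotv u v.
Proof. by rewrite mulr_sumr; apply: eq_bigr => i _; rewrite mxE mulrCA. Qed.

Lemma dotvNr u v : dotv u (- v) = - dotv u v.
Proof. by rewrite -scaleN1r dotvZr mulN1r. Qed.

Lemma dotv_ge0 u : 0 <= dotv u u.
Proof. by apply: sumr_ge0 => i _; rewrite -expr2 sqr_ge0. Qed.

Lemma dotv_eq0 u : (dotv u u == 0) = (u == 0).
Proof.
apply/idP/eqP => [|->]; last by rewrite /dotv big1// => i _; rewrite mxE mul0r.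
rewrite psumr_eq0 => [/allP u0|i _]; last by rewrite -expr2 sqr_ge0.
apply/rowP => i; have := u0 i (mem_index_enum _).
by rewrite -expr2 sqrf_eq0 mxE => /eqP.
Qed.

Lemma enorm_gt0 u : u != 0 -> 0 < enorm u.
Proof. by move=> u0; rewrite sqrtr_gt0 lt_def dotv_eq0 u0 dotv_ge0. Qed.

Lemma enormK u : enorm u ^+ 2 = dotv u u.
Proof. by rewrite sqr_sqrtr// dotv_ge0. Qed.

Lemma enormZ k u : enorm (k *: u) = `|k| * enorm u.
Proof.
by rewrite /enorm dotvZr dotvC dotvZr mulrA -expr2 sqrtrM ?sqr_ge0// sqrtr_sqr.
Qed.

Lemma cauchy_schwarz u v : `|dotv u v| <= enorm u * enorm v.
Proof.
have [->|v0] := eqVneq v 0.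
  have -> : dotv u 0 = 0 by rewrite /dotv big1// => i _; rewrite mxE mulr0.
  by rewrite normr0 mulr_ge0// sqrtr_ge0.
rewrite -ler_sqr ?nnegrE ?mulr_ge0 ?sqrtr_ge0// real_normK ?num_real//.
rewrite exprMn !enormK.
have vv : 0 < dotv v v by rewrite -enormK exprn_gt0// enorm_gt0.
(* This square norm equals (v.v) times (u.u)(v.v) - (u.v)^2. *)
have := dotv_ge0 (dotv v v *: u - dotv u v *: v).
rewrite dotvDr dotvNr !dotvZr ![dotv (_ - _) _]dotvC !dotvDr !dotvNr !dotvZr.
rewrite (dotvC v u) -subr_ge0 => h.
rewrite -(pmulr_rge0 _ vv); apply: le_trans h _.
by rewrite le_eqVlt; apply/orP; left; apply/eqP; ring.
Qed.

Lemma unit_dotv u : u != 0 -> dotv ((enorm u)^-1 *: u) ((enorm u)^-1 *: u) = 1.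
Proof.
move=> u0; rewrite -enormK enormZ ger0_norm ?invr_ge0 ?sqrtr_ge0//.
by rewrite mulVf ?expr1n// gt_eqF// enorm_gt0.
Qed.

End euclidean.

(** The product with the gradient is constant on the hyperplane, so Cauchy-Schwarz gives a lower
    bound, and the infimum is attained. *)
Lemma tangent_distE (R : realType) (n : nat) (F : 'rV[R]_n.+1 -> R)
    (p : 'rV[R]_n.+1) : grad F p != 0 ->
  tangent_dist F p = `|dotv (grad F p) p| / enorm (grad F p).
Proof.
move=> g0; have ng := enorm_gt0 _ g0; rewrite /tangent_dist.
set g := grad F p in g0 ng *; set d := `|_| / _.
have lb : lbound [set enorm q | q in tangent_hyperplane F p] d.
  move=> _ [q /= hq <-]; rewrite ler_pdivrMr// mulrC.
  have -> : dotv g p = dotv g q.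
    by apply/eqP; rewrite eq_sym -subr_eq0 -dotvNr -dotvDr -/g hq.
  exact: cauchy_schwarz.
(* The foot of the perpendicular from the origin. *)
have md : [set enorm q | q in tangent_hyperplane F p] d.
  exists ((dotv g p / enorm g ^+ 2) *: g).
    rewrite /tangent_hyperplane /= dotvDr dotvNr dotvZr -enormK divfK ?subrr//.
    by rewrite expf_neq0// gt_eqF.
  rewrite enormZ normrM normfV (ger0_norm (sqr_ge0 _)) /d.
  by field; rewrite gt_eqF.
apply/eqP; rewrite eq_le ge_inf//=; last by exists d.
by apply: lb_le_inf => //; exists d.
Qed.

(** * Differentiation tools *)

(** Both functions have the same first-order expansion at [x]. This transfers differentiability from
    closed formulas to partial derivatives that match them only locally. *)
Lemma near_eq_differentiable (R : numFieldType) (V W : normedModType R)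
    (f g : V -> W) (x : V) :
  {near x, f =1 g} -> differentiable g x -> differentiable f x.
Proof.
move=> fg dg.
have fe : f \o shift x = cst (f x) + 'd g x +o_ 0 id.
  apply/eqaddoP => e e0.
  have /eqaddoP/(_ e e0) ge := diff_locally dg.
  have fgs : \forall h \near 0, f (h + x) = g (h + x).
    by move: fg; rewrite (near_shift 0) subr0.
  near=> h; rewrite [X in `|X|](_ : _ = (g \o shift x - (cst (g x) + 'd g x)) h).
    by near: h.
  rewrite !fctE /=; congr (_ - (_ + _)); first by near: h.
  exact: nbhs_singleton fg.
apply/diff_locallyP.
have dc := diff_continuous dg.
by rewrite (diff_unique dc fe).
Unshelve. all: by end_near. Qed.

Lemma is_derive_comp1 (R : numFieldType) (V : normedModType R) (f : V -> R)
    (g : R -> R) (x v : V) (df dg : R) :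
  differentiable f x -> is_derive x v f df -> is_derive (f x) 1 g dg ->
  is_derive x v (g \o f) (dg * df).
Proof.
move=> fx fd gd.
have gx : differentiable g (f x) by apply/derivable1_diffP; case: gd.
apply: DeriveDef; first exact/diff_derivable/differentiable_comp.
rewrite deriveE; last exact: differentiable_comp.
rewrite diff_comp//= deriv1E; last by case: gd.
by rewrite derive1E -(deriveE _ fx) !derive_val mulrC.
Qed.

Lemma is_derive_sqrtVX (R : realType) (k : nat) (t : R) : 0 < t ->
  is_derive t 1 (fun t => Num.sqrt t ^- k)
    (- (k%:R / 2 * Num.sqrt t ^- k.+2)).
Proof.
move=> t0; have s0 : Num.sqrt t != 0 by rewrite gt_eqF// sqrtr_gt0.
have := is_derive1_sqrt t0 => ds.
have -> : (fun t : R => Num.sqrt t ^- k) =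
    (fun y => ((Num.sqrt ^+ k : R -> R) y)^-1).
  by apply/funext => y; rewrite exprfctE.
have sk : (Num.sqrt ^+ k : R -> R) t != 0 by rewrite exprfctE expf_neq0.
apply: (@is_derive_eq _ _ _ _ _ _ _ _ (is_deriveV sk (is_deriveX k ds))).
rewrite exprfctE /GRing.scale /=.
case: k {sk} => [|k] /=; first by rewrite !mul0r mulr0 oppr0.
by rewrite !exprS; field; rewrite s0 expf_neq0.
Qed.

(** * The sheets and the powers of the radius *)

Section sheet.
Context {R : realType} {n : nat}.
Implicit Types (x q v : 'rV[R]_n.+1) (i j : 'I_n.+1).

(* The coordinates x^1, ..., x^n, extended by 0 at the last index so that all
   partial derivatives are given by uniform formulas. *)
Definition hcoord i x : R := if i == ord_max then 0 else x 0 i.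

Definition radius x : R := Num.sqrt (sqradius x).

Definition sheet (e : R) x : R := radius x ^- n - e * x 0 ord_max.

Lemma widen_ord_neq_max (i : 'I_n) : (widen_ord (leqnSn n) i == ord_max) = false.
Proof. by apply/negP => /eqP/(congr1 val)/= ni; have := ltn_ord i; rewrite ni ltnn. Qed.

Lemma sqradius_hcoord x : sqradius x = \sum_i hcoord i x ^+ 2.
Proof.
rewrite big_ord_recr /= {2}/hcoord eqxx expr0n addr0.
by apply: eq_bigr => i _; rewrite /hcoord widen_ord_neq_max.
Qed.

Lemma sqradius_ge0 x : 0 <= sqradius x.
Proof. by apply: sumr_ge0 => i _; exact: sqr_ge0. Qed.

Lemma radius_gt0 x : 0 < sqradius x -> 0 < radius x.
Proof. by rewrite sqrtr_gt0. Qed.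

Lemma radiusK x : radius x ^+ 2 = sqradius x.
Proof. by rewrite sqr_sqrtr ?sqradius_ge0. Qed.

Lemma is_derive_coord x v j : is_derive x v (fun y : 'rV[R]_n.+1 => y 0 j) (v 0 j).
Proof.
apply: DeriveDef; first exact/diff_derivable/differentiable_coord.
have := derive_mx (@derivable_id _ _ x v).
by rewrite derive_id => /matrixP/(_ 0 j) ->; rewrite mxE.
Qed.

Lemma differentiable_hcoord i x : differentiable (hcoord i) x.
Proof.
rewrite /hcoord; case: (i == ord_max); first exact: differentiable_cst.
exact: differentiable_coord.
Qed.

Lemma is_derive_hcoord x i j :
  is_derive x (delta_mx 0 i) (hcoord j) ((i == j) && (j != ord_max))%:R.
Proof.
rewrite /hcoord; have [jm|jm] := eqVneq j ord_max.
  by rewrite andbF; exact: is_derive_cst.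
apply: is_derive_eq (is_derive_coord _ _ _) _.
by rewrite mxE eqxx andbT eq_sym.
Qed.

Lemma sqradius_fctE : @sqradius R n = \sum_i hcoord i ^+ 2.
Proof.
apply/funext => x; rewrite fct_sumE sqradius_hcoord.
by apply: eq_bigr => i _; rewrite exprfctE.
Qed.

Lemma differentiable_sqradius x : differentiable (@sqradius R n) x.
Proof.
rewrite sqradius_fctE; apply: differentiable_sum => i.
exact/differentiableX/differentiable_hcoord.
Qed.

Lemma is_derive_sqradius x i :
  is_derive x (delta_mx 0 i) (@sqradius R n) (2 * hcoord i x).
Proof.
rewrite sqradius_fctE; apply: is_derive_eq.
  by apply: is_derive_sum => j; apply: is_deriveX; exact: is_derive_hcoord.
rewrite (bigD1 i)//= big1 => [|j ji]; last first.
  by rewrite eq_sym (negbTE ji) /= scaler0.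
rewrite eqxx addr0 expr1 /GRing.scale /=.
by rewrite /hcoord; case: eqVneq => _; rewrite !(mulr0, mulr1).
Qed.

(** Chain rule through r^2, whose partial 2 x^i absorbs the 1/2 of the square root. The cases
    [k = n] and [k = n.+2] serve the first and second derivatives. *)
Lemma is_derive_radiusVX k x i : 0 < sqradius x ->
  is_derive x (delta_mx 0 i) (fun y => radius y ^- k)
    (- (k%:R * radius x ^- k.+2 * hcoord i x)).
Proof.
move=> x0; have := is_derive_comp1 _ _ _ _ _ _ _ _ (differentiable_sqradius x)
  (is_derive_sqradius x i) (is_derive_sqrtVX _ k _ x0).
move=> /is_derive_eq; apply.
have r0 : radius x != 0 by rewrite gt_eqF// radius_gt0.
rewrite -/(radius x); field; exact: expf_neq0.
Qed.

Lemma differentiable_radiusVX k x : 0 < sqradius x ->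
  differentiable (fun y => radius y ^- k) x.
Proof.
move=> x0; apply: (@differentiable_comp _ _ _ _ _ (fun t => Num.sqrt t ^- k)).
  exact: differentiable_sqradius.
by apply/derivable1_diffP; case: (is_derive_sqrtVX _ k _ x0).
Qed.

Lemma near_sqradius_gt0 x : 0 < sqradius x -> \forall q \near x, 0 < sqradius q.
Proof.
have /cvgr_gt := differentiable_continuous (differentiable_sqradius x).
exact.
Qed.

(** * First and second derivatives of the sheet functions *)

Definition dsheet (e : R) i x : R :=
  - (n%:R * radius x ^- n.+2 * hcoord i x) - e * (i == ord_max)%:R.

(** The sign [e] is absent because the last coordinate enters linearly: both sheets have the same
    Hessian formula. *)
Definition ddsheet i j x : R :=
  n%:R * n.+2%:R * radius x ^- n.+4 * hcoord i x * hcoord j x -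
  n%:R * radius x ^- n.+2 * ((i == j) && (j != ord_max))%:R.

Lemma differentiable_sheet e x : 0 < sqradius x -> differentiable (sheet e) x.
Proof.
move=> x0; apply: differentiableB; first exact: differentiable_radiusVX.
exact/differentiableZ/differentiable_coord.
Qed.

Lemma partial_sheet e i x : 0 < sqradius x -> partial i (sheet e) x = dsheet e i x.
Proof.
move=> x0; apply: derive_val; apply: is_derive_eq.
  apply: is_deriveB; first exact: is_derive_radiusVX.
  exact/is_deriveZ/is_derive_coord.
by rewrite /dsheet mxE eqxx eq_sym.
Qed.

Lemma near_partial_sheet e i x : 0 < sqradius x ->
  {near x, partial i (sheet e) =1 dsheet e i}.
Proof. by move=> /near_sqradius_gt0; apply: filterS => q; exact: partial_sheet. Qed.

Lemma dsheet_fctE e i : dsheet e i =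
  (- n%:R) *: ((fun x => radius x ^- n.+2) * hcoord i) -
  cst (e * (i == ord_max)%:R).
Proof. by apply/funext => x; rewrite !fctE /dsheet /GRing.scale /=; ring. Qed.

Lemma differentiable_dsheet e i x : 0 < sqradius x -> differentiable (dsheet e i) x.
Proof.
move=> x0; rewrite dsheet_fctE; apply: differentiableB => //.
apply/differentiableZ/differentiableM; first exact: differentiable_radiusVX.
exact: differentiable_hcoord.
Qed.

Lemma partial_dsheet e i j x : 0 < sqradius x ->
  partial i (dsheet e j) x = ddsheet i j x.
Proof.
move=> x0; rewrite dsheet_fctE; apply: derive_val; apply: is_derive_eq.
  apply: is_deriveB; apply: is_deriveZ; apply: is_deriveM.
    exact: is_derive_radiusVX.
  exact: is_derive_hcoord.
rewrite /ddsheet /GRing.scale /=; ring.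
Qed.

Lemma partial_partial_sheet e i j x : 0 < sqradius x ->
  partial i (partial j (sheet e)) x = ddsheet i j x.
Proof.
move=> x0; rewrite -(partial_dsheet e)// /partial.
(* Differentiating again requires the first-order formula on a neighbourhood, not just at [x]. *)
by apply: near_eq_derive; exact: near_partial_sheet.
Qed.

Lemma differentiable_ddsheet i j x : 0 < sqradius x -> differentiable (ddsheet i j) x.
Proof.
move=> x0.
have -> : ddsheet i j =
    (n%:R * n.+2%:R) *: ((fun x => radius x ^- n.+4) * (hcoord i * hcoord j)) -
    (n%:R * ((i == j) && (j != ord_max))%:R) *: (fun x => radius x ^- n.+2).
  by apply/funext => y; rewrite !fctE /ddsheet /GRing.scale /=; ring.
apply: differentiableB; apply: differentiableZ; last exact: differentiable_radiusVX.
apply: differentiableM; first exact: differentiable_radiusVX.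
by apply: differentiableM; exact: differentiable_hcoord.
Qed.

Lemma C2_near_sheet e x : 0 < sqradius x -> C2_near (sheet e) x.
Proof.
move=> /near_sqradius_gt0; apply: filterS => q q0; split.
- exact: differentiable_sheet.
- by move=> i; apply: near_eq_differentiable (near_partial_sheet _ _ _ q0) _;
    exact: differentiable_dsheet.
move=> i j; apply: differentiable_continuous.
apply: near_eq_differentiable (differentiable_ddsheet i j q q0).
by apply: filterS (near_sqradius_gt0 _ q0) => y; exact: partial_partial_sheet.
Qed.

Lemma grad_sheet_neq0 e x : e != 0 -> 0 < sqradius x -> grad (sheet e) x != 0.
Proof.
move=> e0 x0; apply/eqP => /rowP/(_ ord_max)/eqP.
rewrite !mxE partial_sheet// /dsheet /hcoord eqxx mulr0 oppr0 sub0r mulr1.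
by rewrite oppr_eq0 (negbTE e0).
Qed.

(** * Curvature, support function and Tzitzeica function of a sheet *)

Lemma det_bordered_hessian_sheet e x : (0 < n)%N -> e ^+ 2 = 1 -> 0 < sqradius x ->
  \det (bordered_hessian (sheet e) x) =
  n.+1%:R * (- n%:R) ^+ n * radius x ^- (n.+2 * n).
Proof.
move=> n0 e2 x0; set u := grad (sheet e) x.
have r0 : radius x != 0 by rewrite gt_eqF// radius_gt0.
have nR : n%:R != 0 :> R by rewrite pnatr_eq0 -lt0n.
have n2R : n.+2%:R != 0 :> R by rewrite pnatr_eq0.
have [al alE] : exists a, a = - (n%:R * radius x ^- n.+2) by eexists.
have [ga gaE] : exists a, a = n%:R * n.+2%:R * radius x ^- n.+4 by eexists.
have al0 : al != 0 by rewrite alE oppr_eq0 mulf_neq0// invr_eq0 expf_neq0.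
have ga0 : ga != 0 by rewrite gaE !mulf_neq0// invr_eq0 expf_neq0.
have pE i : partial i (sheet e) x = al * hcoord i x - e * (i == ord_max)%:R.
  by rewrite partial_sheet// /dsheet alE mulNr.
have uE i : u 0 i = al * hcoord i x - e * (i == ord_max)%:R by rewrite mxE pE.
(* Let h be the row of the [hcoord i x] and b the last basis row, so h = (u + e b) / al.
   Substituting this for one factor of ga h^T h, then for the other, gives [w], [w'] and the
   leftover corner ga e^2 / al^2. *)
pose d : 'rV[R]_n.+1 := \row_i if i == ord_max then ga / al ^+ 2 else al.
pose w : 'rV[R]_n.+1 := \row_i (ga / al * hcoord i x).
pose w' : 'rV[R]_n.+1 := \row_i (ga / al ^+ 2 * e * (i == ord_max)%:R).
(* Modulo the border, the row vector (hcoord i x)_i is (e / al) times the last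
   basis vector, so the Hessian reduces to a diagonal matrix. *)
have HE : hessian (sheet e) x = diag_mx d + (u^T *m w + w'^T *m u).
  apply/matrixP => i j.
  rewrite mxE partial_partial_sheet// !mxE !big_ord1 !mxE !pE /ddsheet -gaE.
  rewrite -mulNr -alE.
  (* Only the corner entry uses e^2 = 1. *)
  have [->|im] := eqVneq i ord_max; have [->|jm] := eqVneq j ord_max;
    rewrite /hcoord ?eqxx ?[ord_max == _]eq_sym ?(negbTE im) ?(negbTE jm) ?andbT ?andbF /=.
  - by field: e2.
  - by field.
  - by field.
  - by rewrite -mulr_natr; field.
rewrite /bordered_hessian HE det_bordered_add det_bordered_diag; last first.
  move=> i; rewrite mxE; case: ifP => // _.
  by rewrite mulf_neq0// invr_eq0 expf_neq0.
have dE (i : 'I_n) : d 0 (widen_ord (leqnSn n) i) = al by rewrite mxE widen_ord_neq_max.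
have dmax : d 0 ord_max = ga / al ^+ 2 by rewrite mxE eqxx.
have umax : u 0 ord_max = - e by rewrite uE /hcoord eqxx mulr0 sub0r mulr1.
rewrite !big_ord_recr /= dmax umax (sqrrN e) e2.
rewrite (eq_bigr (fun=> al)) => [|i _]; last exact: dE.
rewrite prodr_const card_ord.
rewrite (eq_bigr (fun i : 'I_n => al * x 0 (widen_ord (leqnSn n) i) ^+ 2)); last first.
  move=> i _; rewrite dE uE /hcoord widen_ord_neq_max mulr0 subr0.
  by field.
rewrite -mulr_sumr -/(sqradius x) -radiusK.
have -> : al ^+ n * (ga / al ^+ 2) * (al * radius x ^+ 2 + 1 / (ga / al ^+ 2)) =
  al ^+ n * (ga / al * radius x ^+ 2 + 1) by field; rewrite al0 ga0.
(* The bracket thus becomes -(n+1), whose sign cancels the one from [det_bordered_diag]. *)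
have -> : ga / al * radius x ^+ 2 = - n.+2%:R.
  rewrite gaE alE -[n.+4]addn2 exprD -[n.+2]addn2; field.
  by rewrite nR r0 !expf_neq0.
have -> : al ^+ n = (- n%:R) ^+ n / radius x ^+ (n.+2 * n).
  by rewrite alE -mulNr expr_div_n -exprM.
by rewrite -[n.+2%:R]natr1; ring.
Qed.

(** Euler's relation: r^(-n), homogeneous of degree -n, contributes - n r^(-n); the linear term
    contributes - e x^(n+1), which is - r^(-n) on the sheet. *)
Lemma dotv_grad_sheet e x : 0 < sqradius x -> sheet e x = 0 ->
  dotv (grad (sheet e) x) x = - (n.+1%:R * radius x ^- n).
Proof.
move=> x0 Fx; have r0 : radius x != 0 by rewrite gt_eqF// radius_gt0.
have ex : e * x 0 ord_max = radius x ^- n.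
  by apply/esym/eqP; rewrite -subr_eq0 -[X in X == _]/(sheet e x) Fx.
rewrite /dotv big_ord_recr /= mxE partial_sheet// /dsheet /hcoord eqxx.
rewrite mulr0 oppr0 sub0r mulr1 mulNr ex.
rewrite (eq_bigr (fun i : 'I_n => - (n%:R * radius x ^- n.+2) *
    x 0 (widen_ord (leqnSn n) i) ^+ 2)); last first.
  move=> i _; rewrite mxE partial_sheet// /dsheet /hcoord widen_ord_neq_max /=.
  by ring.
rewrite -mulr_sumr -/(sqradius x) -radiusK -natr1 -[n.+2]addn2 exprD.
by field; rewrite r0 expf_neq0.
Qed.

Lemma tzitzeica_sheet e x : (0 < n)%N -> e ^+ 2 = 1 -> 0 < sqradius x ->
  sheet e x = 0 ->
  tzitzeica (sheet e) (- unit_normal (sheet e) x) x =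
  (- n%:R) ^+ n / n.+1%:R ^+ n.+1.
Proof.
move=> n0 e2 x0 Fx; have r0 := radius_gt0 _ x0.
have e0 : e != 0 by rewrite -sqrf_eq0 e2 oner_eq0.
have g0 := grad_sheet_neq0 _ _ e0 x0; have ng := enorm_gt0 _ g0.
(* The opposite normal gives a factor -1, which cancels the minus sign in [gauss_curvature]. *)
rewrite /tzitzeica /unit_normal opprK dotvNr unit_dotv// mulN1r.
rewrite /gauss_curvature tangent_distE// dotv_grad_sheet//.
rewrite det_bordered_hessian_sheet// normrN ger0_norm; last first.
  by rewrite mulr_ge0// invr_ge0 exprn_ge0// ltW.
rewrite expr_div_n exprMn exprVn -exprM mulnC [n.+1%:R ^+ n.+2]exprS.
field.
by rewrite !expf_neq0 ?gt_eqF ?ltr0n.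
Qed.

(** * From the sheets to M^n *)

Lemma defines_near_sheet e x : e ^+ 2 = 1 -> 0 < e * x 0 ord_max ->
  0 < sqradius x -> defines_near (@Mn R n) (sheet e) x.
Proof.
move=> e2 ex x0.
have e0 : e != 0 by rewrite -sqrf_eq0 e2 oner_eq0.
split; [exact: C2_near_sheet|exact: grad_sheet_neq0|].
(* Near [x] the last coordinate keeps its sign, which excludes the other sheet: there e x^(n+1) and
   r^(-n) are both positive, so equality of their squares suffices. *)
have /cvgr_gt/(_ _ ex) := differentiable_continuous
  (differentiableZ e (differentiable_coord x 0 ord_max)).
apply: filterS2 (near_sqradius_gt0 _ x0) => q q0 eq.
have r0 := radius_gt0 _ q0.
rewrite /Mn /sheet /=.
have -> : q 0 ord_max ^+ 2 * sqradius q ^+ n =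
    (e * q 0 ord_max) ^+ 2 / (radius q ^- n) ^+ 2.
  have ez : (e * q 0 ord_max) ^+ 2 = q 0 ord_max ^+ 2 by rewrite exprMn e2 mul1r.
  by rewrite ez -radiusK -exprM mulnC exprM exprVn invrK.
have rn : 0 < radius q ^- n by rewrite invr_gt0 exprn_gt0.
split=> [/divr1_eq|/subr0_eq <-]; last first.
  by rewrite divff// expf_neq0// gt_eqF.
by move/eqP; rewrite eqrXn2 ?ltW// => /eqP ->; rewrite subrr.
Qed.

(** The value -1 at a zero last coordinate follows [Mn_eq]; no point of M^n has one. *)
Definition sheet_sign x : R := if 0 < x 0 ord_max then 1 else -1.

Lemma sheet_sign_sqr x : sheet_sign x ^+ 2 = 1.
Proof. by rewrite /sheet_sign; case: ifP => _; rewrite ?sqrrN expr1n. Qed.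

Lemma Mn_eqE x : Mn_eq x = sheet (sheet_sign x).
Proof.
rewrite /Mn_eq /sheet_sign; case: ifP => _; apply/funext => y.
  by rewrite /sheet mul1r.
rewrite /graph_eq /profile /sheet mxE eqxx mulN1r; congr (Num.sqrt _ ^- n - _).
by apply: eq_bigr => i _; rewrite mxE widen_ord_neq_max.
Qed.

Lemma Mn_sqradius_gt0 x : (0 < n)%N -> Mn x -> 0 < sqradius x.
Proof.
rewrite lt_def sqradius_ge0 andbT /Mn /= => n0 Mx; apply/eqP => x0.
by move/eqP: Mx; rewrite x0 expr0n eqn0Ngt n0 mulr0 eq_sym oner_eq0.
Qed.

Lemma sheet_sign_gt0 x : Mn x -> 0 < sheet_sign x * x 0 ord_max.
Proof.
rewrite /Mn /sheet_sign /=; have [x0|x0|x0] := ltgtP 0 (x 0 ord_max) => Mx.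
- by rewrite mul1r.
- by rewrite mulN1r oppr_gt0.
- by move/eqP: Mx; rewrite -x0 expr0n mul0r eq_sym oner_eq0.
Qed.

Lemma hypersurface_Mn : (0 < n)%N -> hypersurface (@Mn R n) (@Mn_eq R n).
Proof.
move=> n0 p Mp; rewrite Mn_eqE; apply: defines_near_sheet.
- exact: sheet_sign_sqr.
- exact: sheet_sign_gt0.
- exact: Mn_sqradius_gt0.
Qed.

Lemma tzitzeica_Mn x : (0 < n)%N -> Mn x ->
  tzitzeica (Mn_eq x) (Mn_normal x) x = (- n%:R) ^+ n / n.+1%:R ^+ n.+1.
Proof.
move=> n0 Mx; rewrite /Mn_normal Mn_eqE.
(* The local description, read at [x] itself, says that the sheet function vanishes there. *)
have [_ _ /nbhs_singleton [/(_ Mx) Fx _]] := hypersurface_Mn n0 x Mx.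
apply: tzitzeica_sheet => //; first exact: sheet_sign_sqr.
- exact: Mn_sqradius_gt0.
- by rewrite -Mn_eqE.
Qed.

End sheet.

Theorem mainTheorem1 (R : realType) (n : nat) (hn : (0 < n)%N) :
  tzitzeica_hypersurface (@Mn R n) (@Mn_eq R n) (@Mn_normal R n) /\
  (forall p : 'rV[R]_n.+1, Mn p ->
     tzitzeica (Mn_eq p) (Mn_normal p) p
       = (- n%:R) ^+ n / n.+1%:R ^+ n.+1).
Proof.
have tzM p : Mn p -> _ := fun Mp => @tzitzeica_Mn R n p hn Mp.
split=> //; split; first exact: hypersurface_Mn.
by exists ((- n%:R) ^+ n / n.+1%:R ^+ n.+1) => p; exact: tzM.
Qed.
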